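(* Let $G$ be a finite graph. For every set $\mathcal P$ of profiles of clique separations of $G$ there is a nested set $N=N(\mathcal P)$ of separations of $G$ which efficiently distinguishes all the distinguishable profiles in $\mathcal P$ (i.e. for every distinguishable pair $P,P'\in\mathcal P$ it contains a clique separation distinguishing $P$ and $P'$ efficiently) and is canonical: $N(\mathcal P^\alpha)=N(\mathcal P)^\alpha$ for every automorphism $\alpha$ of $G$.
   Context: A separation of $G=(V,E)$ is a pair $(A,B)$ with $A\cup B=V$ and no edge between $A\setminus B$ and $B\setminus A$; its inverse is $(B,A)$, its order is $|A\cap B|$, and $(A,B)\le(C,D)$ iff $A\subseteq C$, $B\supseteq D$; meet is $(A\cap C,B\cup D)$. Two separations are nested if they have comparable orientations; a set is nested if its elements are pairwise nested. A clique separation is one with $G[A\cap B]$ complete; $S_k$ is the set of clique separations of order $<k$. A profile of clique separations (of order $k$) is a set $P$ containing exactly one orientation of each element of $S_k$, consistent (no $\vec r,\vec s\in P$ with $\overleftarrow r<\vec s$) and such that for all $\vec r,\vec s\in P$, $\overleftarrow r\wedge\overleftarrow s\notin P$. A clique separation distinguishes two profiles if they contain different orientations of it, efficiently if of minimal order among all clique separations distinguishing them; profiles are distinguishable if some clique separation distinguishes them. An automorphism $\alpha$ of $G$ acts on separations by $(A,B)^\alpha=(\alpha(A),\alpha(B))$, and hence on profiles and sets of separations. *)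

(* Defs.v *)
(* A finite simple graph is a symmetric irreflexive relation on a
   finite type of vertices. *)
From mathcomp Require Import all_boot all_fingroup.

Set Implicit Arguments.
Unset Strict Implicit.
Unset Printing Implicit Defensive.

(* Ordered pairs (A, B) of vertex sets.  Separations are represented by their
   orientations throughout; a set of separations need not contain both. *)
Notation vpair T := ({set T} * {set T})%type.

Section Separations.
Variables (T : finType) (e : rel T).
Implicit Types (r s t : vpair T) (P Q N : {set vpair T}).

Definition separation s : bool :=
  (s.1 :|: s.2 == [set: T]) &&
  [forall x in s.1 :\: s.2, forall y in s.2 :\: s.1, ~~ e x y].

Definition inv_sep s : vpair T := (s.2, s.1).

Definition orientations s : {set vpair T} := [set s; inv_sep s].

Definition sep_order s : nat := #|s.1 :&: s.2|.

Definition sep_le r s : bool := (r.1 \subset s.1) && (s.2 \subset r.2).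

Definition sep_lt r s : bool := sep_le r s && (r != s).

Definition sep_meet r s : vpair T := (r.1 :&: s.1, r.2 :|: s.2).

Definition nested r s : bool :=
  [exists r' in orientations r, exists s' in orientations s,
    sep_le r' s' || sep_le s' r'].

Definition nested_set N : Prop := {in N &, forall r s, nested r s}.

Definition clique (A : {set T}) : bool :=
  [forall x in A, forall y in A, (x != y) ==> e x y].

Definition clique_separation s : bool :=
  separation s && clique (s.1 :&: s.2).

Definition clique_seps (k : nat) : {set vpair T} :=
  [set s | clique_separation s & sep_order s < k].

(* The cardinality condition also makes sense when s equals its inverse. *)
Definition orients (k : nat) P : Prop :=
  P \subset clique_seps k /\
  {in clique_seps k, forall s, #|P :&: orientations s| = 1}.

Definition consistent P : Prop :=
  {in P &, forall r s, ~~ sep_lt (inv_sep r) s}.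

Definition profile_of_order (k : nat) P : Prop :=
  [/\ orients k P,
      consistent P
    & {in P &, forall r s, sep_meet (inv_sep r) (inv_sep s) \notin P}].

Definition profile P : Prop := exists k : nat, profile_of_order k P.

Definition distinguishes s P Q : Prop :=
  clique_separation s /\
  exists r t, [/\ r \in P :&: orientations s,
                  t \in Q :&: orientations s & r != t].

Definition distinguishes_efficiently s P Q : Prop :=
  distinguishes s P Q /\
  forall t, distinguishes t P Q -> sep_order s <= sep_order t.

Definition distinguishable P Q : Prop := exists s, distinguishes s P Q.

Definition automorphism (a : {perm T}) : Prop := {mono a : x y / e x y}.

End Separations.

Definition sep_act (T : finType) (a : {perm T}) (s : vpair T) : vpair T :=
  (a @: s.1, a @: s.2).

Definition seps_act (T : finType) (a : {perm T}) (P : {set vpair T}) :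
    {set vpair T} :=
  sep_act a @: P.

Definition profiles_act (T : finType) (a : {perm T})
    (PP : {set {set vpair T}}) : {set {set vpair T}} :=
  seps_act a @: PP.

(* Main.v *)
(* Clique separations are distinguished order by order.  Among the efficient
   separators of order k of a pair of profiles, consider those nested with
   everything chosen at lower orders, and choose all of them that cross the
   fewest such candidates of order k (for all pairs).  No arbitrary
   choice is made, so this is canonical.

   A clique is never split by a separation, so if r = (A, B) and s = (C, D) are
   clique separations, we may orient them such that A :&: B lies in C and
   C :&: D lies in A.  Then all corners but (A :&: C, B :|: D) are clique
   separations with separator inside that of r or s.  A profile living on a
   given side of r lives in one of the two corners on that side, and this corner
   still distinguishes it from the profile on the other side.  If r and s have
   different orders, this replaces the one of larger order by a separation
   nested with the other; if they have the same order, opposite corners can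
   be substituted for r and s, and as the number of separations crossed is
   strictly submodular on opposite corners, r and s were not both optimal. *)
Require Import Defs.
From mathcomp Require Import all_boot all_fingroup.
From mathcomp Require Import zify.

Set Implicit Arguments.
Unset Strict Implicit.
Unset Printing Implicit Defensive.

(** * Canonical nested selections *)

Section Splinter.
Variables (X : finType) (nest : rel X) (ord : X -> nat).
Implicit Types (F : {set {set X}}) (A N M : {set X}).

Definition crossers M s : {set X} := [set t in M | ~~ nest t s].

Definition admissible N k A : {set X} :=
  [set s in A | (ord s == k) && (crossers N s == set0)].

Definition candidates F N k : {set X} := \bigcup_(A in F) admissible N k A.

Definition optimal F N k A : {set X} :=
  [set s in admissible N k A | [forall t in admissible N k A,
     #|crossers (candidates F N k) s| <= #|crossers (candidates F N k) t|]].

(** Stage [k] treats order exactly [k], so [splinter F n] covers the orders below [n]. *)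
Fixpoint splinter F n : {set X} :=
  if n is k.+1 then
    let N := splinter F k in N :|: \bigcup_(A in F) optimal F N k A
  else set0.

Lemma crossers0P N s :
  reflect {in N, forall t, nest t s} (crossers N s == set0).
Proof.
apply: (iffP eqP) => [N0 t tN|nestN].
  have : t \notin crossers N s by rewrite N0 inE.
  by rewrite inE tN negbK.
by apply/setP=> t; rewrite !inE; apply/andP=> -[/nestN->].
Qed.

Lemma splinterP F n s : s \in splinter F n ->
  exists A, [/\ A \in F, s \in A & ord s < n].
Proof.
elim: n => [|n IHn]; first by rewrite inE.
rewrite inE => /orP[/IHn[A [AF sA lt_sn]]|]; first by exists A; split=> //; lia.
case/bigcupP=> A AF; rewrite !inE -!andbA => /and3P[sA /eqP sn _].
by exists A; split=> //; lia.
Qed.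

Lemma subset_splinter F m n : m <= n -> splinter F m \subset splinter F n.
Proof.
move=> le_mn; rewrite -(subnK le_mn); elim: (n - m) => [|k IHk] //=.
exact: subset_trans IHk (subsetUl _ _).
Qed.

(** * Equivariance under maps preserving nestedness and order *)

Section Equivariance.
Variable f : X -> X.
Hypothesis f_inj : injective f.
Hypothesis nest_f : {mono f : x y / nest x y}.
Hypothesis ord_f : forall x, ord (f x) = ord x.

Let fF F : {set {set X}} := [set f @: A | A : {set X} in F].

(** An injective self-map of a finite type is onto, so every [y] has the form [f x] and the two
    predicates can be compared at [x]. *)
Lemma imset_filter A (p q : pred X) : (forall x, q (f x) = p x) ->
  f @: [set x in A | p x] = [set y in f @: A | q y].
Proof.
move=> qf; apply/setP=> y; have [g fK gK] := injF_bij f_inj.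
by rewrite -(gK y) !inE !mem_imset // !inE qf.
Qed.

Lemma crossers_imset M s : crossers (f @: M) (f s) = f @: crossers M s.
Proof.
by rewrite (@imset_filter _ _ (fun t => ~~ nest t (f s))) // => x; rewrite nest_f.
Qed.

Lemma admissible_imset N k A :
  admissible (f @: N) k (f @: A) = f @: admissible N k A.
Proof.
rewrite (@imset_filter _ _
  (fun s => (ord s == k) && (crossers (f @: N) s == set0))) // => x.
by rewrite ord_f crossers_imset imset_eq0.
Qed.

Lemma bigcup_imset F (G H : {set X} -> {set X}) :
  (forall A, H (f @: A) = f @: G A) ->
  \bigcup_(A in fF F) H A = f @: \bigcup_(A in F) G A.
Proof.
move=> HG; apply/setP=> y; apply/bigcupP/imsetP.
  case=> _ /imsetP[A AF ->]; rewrite HG => /imsetP[x xA ->].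
  by exists x => //; apply/bigcupP; exists A.
case=> x /bigcupP[A AF xA] ->; exists (f @: A); first exact: imset_f.
by rewrite HG imset_f.
Qed.

Lemma candidates_imset F N k :
  candidates (fF F) (f @: N) k = f @: candidates F N k.
Proof. by apply: bigcup_imset => A; apply: admissible_imset. Qed.

Lemma optimal_imset F N k A :
  optimal (fF F) (f @: N) k (f @: A) = f @: optimal F N k A.
Proof.
rewrite /optimal admissible_imset candidates_imset.
rewrite -(@imset_filter _ (fun s => [forall t in admissible N k A,
     #|crossers (candidates F N k) s| <= #|crossers (candidates F N k) t|])) // => x.
apply/forall_inP/forall_inP => min_x t.
  by move/(imset_f f)/min_x; rewrite !crossers_imset !card_imset.
case/imsetP=> u uA ->; rewrite !crossers_imset !card_imset //; exact: min_x.
Qed.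

Lemma splinter_imset F n : splinter (fF F) n = f @: splinter F n.
Proof.
elim: n => [|n IHn] /=; first by rewrite imset0.
rewrite IHn imsetU; congr (_ :|: _).
by apply: bigcup_imset => A; apply: optimal_imset.
Qed.

End Equivariance.

(** Abstracts a pair of opposite corners [c], [c'] of [r] and [s]. The first clause yields
    strictness, the other three submodularity of the number of crossers. *)
Definition uncrossing r s c c' :=
  [/\ nest s c /\ nest s c',
      (forall t, nest t r -> nest t s -> nest t c /\ nest t c'),
      (forall t, nest t r -> nest t c \/ nest t c')
    & (forall t, nest t s -> nest t c \/ nest t c')].

(** Compare unions and intersections of crossers: what crosses some corner crosses [r] or [s], and
    what crosses both corners crosses both [r] and [s]. The first inclusion is strict, since [s]
    crosses [r] but neither corner. *)
Lemma uncrossing_card M r s c c' : uncrossing r s c c' ->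
  s \in M -> ~~ nest s r ->
  #|crossers M c| + #|crossers M c'| < #|crossers M r| + #|crossers M s|.
Proof.
move=> [[sc sc'] nest2 nestr nests] sM sr.
rewrite -cardsUI -[ltnRHS]cardsUI -addSn leq_add //.
  apply/proper_card/properP; split.
    apply/subsetP=> t; rewrite !inE -!andb_orr => /andP[-> /=].
    rewrite -!negb_and; apply: contra => /andP[tr ts].
    by have [-> ->] := nest2 t tr ts.
  by exists s; rewrite !inE sM ?sr //= sc sc'.
apply/subset_leq_card/subsetP=> t; rewrite !inE => /andP[/andP[-> tc] /andP[_ tc']] /=.
apply/andP; split.
  by apply/negP=> /nestr[]; apply/negP.
by apply/negP=> /nests[]; apply/negP.
Qed.

(** * Nestedness of the selection, and why it meets each set of the family *)

Section Existence.
Variable F : {set {set X}}.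
Hypothesis nest_sym : symmetric nest.
Hypothesis homogeneous : forall A s t,
  A \in F -> s \in A -> t \in A -> ord s = ord t.
Hypothesis splinter_lt : forall A B r s, A \in F -> B \in F ->
  r \in A -> s \in B -> ord r < ord s -> ~~ nest r s ->
  exists c, [/\ c \in B, nest r c & forall t, nest t r -> nest t s -> nest t c].
Hypothesis splinter_eq : forall A B r s, A \in F -> B \in F ->
  r \in A -> s \in B -> ord r = ord s -> ~~ nest r s ->
  (exists c c', [/\ uncrossing r s c c', c \in A & c' \in B]) \/
  (exists c c' d d', [/\ uncrossing r s c c', uncrossing r s d d',
     c \in A /\ c' \in A & d \in B /\ d' \in B]).

(** If [r] and [s] crossed, the corners replacing them would again be admissible: homogeneity fixes
    their order, and the second clause of [uncrossing] keeps them nested with [N]. The strict count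
    then contradicts minimality. *)
Lemma optimal_nest N k A B r s : A \in F -> B \in F ->
  r \in optimal F N k A -> s \in optimal F N k B -> nest r s.
Proof.
move=> AF BF; rewrite inE => /andP[rN /forall_inP min_r].
rewrite inE => /andP[sN /forall_inP min_s]; apply: contraT => rs.
have sM : s \in candidates F N k by apply/bigcupP; exists B.
move: rN sN; rewrite !inE.
case/and3P=> rA /eqP ord_r /crossers0P rN; case/and3P=> sB /eqP ord_s /crossers0P sN.
have adm c c' : uncrossing r s c c' ->
    forall D t, D \in F -> t \in D -> ord t = k ->
      (c \in D -> c \in admissible N k D) /\ (c' \in D -> c' \in admissible N k D).
  move=> [_ nest2 _ _] D t DF tD ord_t; rewrite !inE.
  by split=> cD; rewrite cD (homogeneous DF cD tD) ord_t eqxx /=;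
    apply/crossers0P=> u uN; have [] := nest2 u (rN u uN) (sN u uN).
have lt c c' (u : uncrossing r s c c') :=
  uncrossing_card u sM (etrans (congr1 negb (nest_sym s r)) rs).
case: (splinter_eq AF BF rA sB _ rs); first by rewrite ord_r ord_s.
  case=> c [c' [u cA c'B]].
  have [/(_ cA)/min_r + _] := adm _ _ u A r AF rA ord_r.
  have [_ /(_ c'B)/min_s] := adm _ _ u B s BF sB ord_s.
  have := lt _ _ u; lia.
(* With [x] and [y] the crossing numbers of [r] and [s], minimality in [A] gives [2x < x + y]
   through [c], [c'], and minimality in [B] gives [2y < x + y] through [d], [d']. *)
case=> c [c' [d [d' [u v [cA c'A] [dB d'B]]]]].
have [/(_ cA)/min_r + /(_ c'A)/min_r] := adm _ _ u A r AF rA ord_r.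
have [/(_ dB)/min_s + /(_ d'B)/min_s] := adm _ _ v B s BF sB ord_s.
have := lt _ _ u; have := lt _ _ v; lia.
Qed.

Lemma splinter_nest n : {in splinter F n &, forall r s, nest r s}.
Proof.
elim: n => [|n IHn] r s; rewrite ?inE //=.
have old_new x y : x \in splinter F n ->
    y \in \bigcup_(A in F) optimal F (splinter F n) n A -> nest x y.
  move=> xN /bigcupP[A _]; rewrite !inE => /andP[/and3P[_ _ /crossers0P yN] _].
  exact: yN.
move=> /orP[rN|rO] /orP[sN|sO]; first exact: IHn; first exact: old_new.
  by rewrite nest_sym old_new.
case/bigcupP: rO sO => A AF rA /bigcupP[B BF sB].
exact: optimal_nest rA sB.
Qed.

(** Take [c] in [A] crossing the fewest elements of the lower stages. If it crossed some [r] there,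
    [splinter_lt] would give [d] in [A] nested with [r]; as the lower stages are nested with [r], no
    new crossing arises, so [d] would cross strictly fewer. *)
Lemma admissible_neq0 k A s : A \in F -> s \in A -> ord s = k ->
  exists c, c \in admissible (splinter F k) k A.
Proof.
move=> AF sA ord_s; pose cr t := #|crossers (splinter F k) t|.
case: (@arg_minnP _ s (mem A) cr sA) => c; rewrite inE => cA min_c.
have ord_c : ord c = k by rewrite (homogeneous AF cA sA).
exists c; rewrite !inE cA ord_c eqxx /=; apply/crossers0P=> r rN.
apply: contraT => rc; have [B [BF rB lt_rk]] := splinterP rN.
have [|d [dA rd nest2]] := splinter_lt BF AF rB cA _ rc; first by rewrite ord_c.
have := min_c d dA; rewrite leqNgt => /negP[].
apply/proper_card/properP; split.
  apply/subsetP=> t; rewrite !inE => /andP[tN]; rewrite tN.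
  by apply: contra => tc; apply: nest2 (splinter_nest tN rN) tc.
by exists r; rewrite !inE rN ?rc // rd.
Qed.

Lemma splinter_meets n A s : A \in F -> s \in A -> ord s < n ->
  exists2 c, c \in A & c \in splinter F n.
Proof.
move=> AF sA lt_sn; have [c cadm] := admissible_neq0 AF sA erefl.
pose cr t := #|crossers (candidates F (splinter F (ord s)) (ord s)) t|.
case: (@arg_minnP _ c (mem (admissible (splinter F (ord s)) (ord s) A)) cr cadm).
move=> d; rewrite inE => dadm min_d; exists d; first by move: dadm; rewrite !inE => /andP[].
apply: (subsetP (subset_splinter F lt_sn)).
rewrite /= inE; apply/orP; right; apply/bigcupP; exists A => //.
by rewrite inE dadm; apply/forall_inP.
Qed.

End Existence.
End Splinter.

(** * Nestedness and corners *)

Section Separations.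
Variables (T : finType).
Implicit Types (r s t c : vpair T) (P Q : {set vpair T}).

Lemma inv_sepK : involutive (@inv_sep T).
Proof. by case. Qed.

Lemma sep_le_trans s r t : sep_le r s -> sep_le s t -> sep_le r t.
Proof.
case/andP=> rs1 rs2 /andP[st1 st2]; rewrite /sep_le.
by rewrite (subset_trans rs1 st1) (subset_trans st2 rs2).
Qed.

Lemma sep_le_inv r s : sep_le (inv_sep r) (inv_sep s) = sep_le s r.
Proof. by rewrite /sep_le andbC. Qed.

Lemma sep_le_invC r s : sep_le r (inv_sep s) = sep_le s (inv_sep r).
Proof. by rewrite -sep_le_inv inv_sepK. Qed.

Lemma sep_le_invl r s : sep_le (inv_sep r) s = sep_le (inv_sep s) r.
Proof. by rewrite -sep_le_inv inv_sepK. Qed.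

Lemma sep_meet_lel r s : sep_le (sep_meet r s) r.
Proof. by rewrite /sep_le subsetIl subsetUl. Qed.

Lemma sep_meet_ler r s : sep_le (sep_meet r s) s.
Proof. by rewrite /sep_le subsetIr subsetUr. Qed.

Lemma sep_le_meet t r s : sep_le t r -> sep_le t s -> sep_le t (sep_meet r s).
Proof.
case/andP=> tr1 tr2 /andP[ts1 ts2]; rewrite /sep_le /=.
by rewrite subsetI tr1 ts1 subUset tr2 ts2.
Qed.

Lemma sep_meetC r s : sep_meet r s = sep_meet s r.
Proof. by rewrite /sep_meet setIC setUC. Qed.

Lemma nestedE r s : nested r s =
  [|| sep_le r s, sep_le r (inv_sep s), sep_le (inv_sep r) s
    | sep_le (inv_sep r) (inv_sep s)].
Proof.
apply/exists_inP/idP.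
  case=> r' r'E /exists_inP[s' s'E]; rewrite -(sep_le_inv r' s').
  by case/set2P: r'E => ->; case/set2P: s'E => ->; rewrite ?inv_sepK;
    case/orP=> ->; rewrite ?orbT.
case/or4P=> le_rs; [exists r|exists r|exists (inv_sep r)|exists (inv_sep r)];
  rewrite ?set21 ?set22 //; apply/exists_inP;
  [exists s|exists (inv_sep s)|exists s|exists (inv_sep s)];
  by rewrite ?set21 ?set22 ?le_rs.
Qed.

Lemma nested_invr r s : nested r (inv_sep s) = nested r s.
Proof. by rewrite !nestedE inv_sepK; do 4!case: sep_le. Qed.

Lemma nested_sym : symmetric (@nested T).
Proof.
move=> r s; rewrite !nestedE -(sep_le_inv s r) (sep_le_invC r) (sep_le_invl r s).
by rewrite -(sep_le_inv r s); do 4!case: sep_le.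
Qed.

Lemma nested_invl r s : nested (inv_sep r) s = nested r s.
Proof. by rewrite nested_sym nested_invr nested_sym. Qed.

Lemma nested_le r s : sep_le r s -> nested r s.
Proof. by rewrite nestedE => ->. Qed.

Lemma nested_ge r s : sep_le s r -> nested r s.
Proof. by rewrite nested_sym; apply: nested_le. Qed.

Lemma nested_meetr r s : nested s (sep_meet r s).
Proof. exact/nested_ge/sep_meet_ler. Qed.

Lemma nested_meet_le r s t : sep_le t (inv_sep r) -> nested t (sep_meet r s).
Proof.
move=> tr; rewrite -nested_invr; apply: nested_le; apply: sep_le_trans tr _.
by rewrite sep_le_inv sep_meet_lel.
Qed.

(** Orient [t] below [r] or below [inv_sep r]; the latter lies below the inverse of the corner. If
    [t] is below [r], then [t] below [s] or [inv_sep s] settles the claim, whereas [s] or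
    [inv_sep s] below [t] would be below [r], against the crossing of [r] and [s]. *)
Lemma nested_meet r s t : ~~ nested r s ->
  nested t r -> nested t s -> nested t (sep_meet r s).
Proof.
move=> rs; wlog tr : t / sep_le t r || sep_le t (inv_sep r) => [hw|].
  rewrite (nestedE t r) => /or4P[] le; move: (hw t) (hw (inv_sep t));
  by rewrite le ?orbT !nested_invl // nestedE le ?orbT; auto.
case/orP: tr => [tr _|tr _ _]; last first.
  exact: nested_meet_le.
rewrite nestedE => /or4P[] ts.
- exact/nested_le/sep_le_meet.
- by rewrite sep_meetC; apply: nested_meet_le.
- case/negP: rs; rewrite -nested_invr; apply: nested_ge.
  by apply: sep_le_trans tr; rewrite sep_le_invl.
- by case/negP: rs; apply/nested_ge; apply: sep_le_trans tr; rewrite -sep_le_inv.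
Qed.

(** The two corners lie on opposite sides of [r]. Some orientation of [t] lies below one side of
    [r], hence below the inverse of the corner on the other side. *)
Lemma nested_meet_or r s t : nested t r ->
  nested t (sep_meet r s) \/ nested t (sep_meet (inv_sep r) (inv_sep s)).
Proof.
rewrite nestedE -{1}(inv_sepK r) => /or4P[/nested_meet_le|/nested_meet_le||] H; auto.
- by right; rewrite -nested_invl; apply: nested_meet_le; rewrite inv_sepK.
- by left; rewrite -nested_invl; apply: nested_meet_le.
Qed.

Lemma uncrossing_meet r s : ~~ nested r s ->
  uncrossing (@nested T) r s (sep_meet r s) (sep_meet (inv_sep r) (inv_sep s)).
Proof.
move=> rs; split.
- by split; last rewrite -nested_invl; apply: nested_meetr.
- move=> t tr ts; split; first exact: nested_meet.
  by apply: nested_meet; rewrite ?nested_invl nested_invr.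
- by move=> t; apply: nested_meet_or.
- move=> t; rewrite sep_meetC [sep_meet (inv_sep r) _]sep_meetC.
  exact: nested_meet_or.
Qed.

End Separations.

(** * Clique separations and profiles *)

Section CliqueSeparations.
Variables (T : finType) (e : rel T).
Hypothesis e_sym : symmetric e.
Implicit Types (r s t c : vpair T) (P Q : {set vpair T}).

Lemma separationP s : reflect
  ((forall x, (x \in s.1) || (x \in s.2)) /\
   (forall x y, x \notin s.2 -> y \notin s.1 -> ~~ e x y))
  (separation e s).
Proof.
apply: (iffP andP) => [[/eqP cover /forall_inP noedge]|[cover noedge]].
  have cov x : (x \in s.1) || (x \in s.2) by rewrite -in_setU cover inE.
  split=> // x y xs ys; have := cov x; have := cov y.
  rewrite (negPf xs) (negPf ys) orbF /= => y2 x1.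
  by apply: (forall_inP (noedge x _)); rewrite inE ?xs ?ys.
split; first by apply/eqP/setP=> x; rewrite !inE cover.
apply/forall_inP=> x /setDP[_ x2]; apply/forall_inP=> y /setDP[_ y1].
exact: noedge.
Qed.

Lemma cliqueP (A : {set T}) :
  reflect {in A &, forall x y, x != y -> e x y} (clique e A).
Proof.
apply: (iffP forall_inP) => [cl x y xA yA|cl x xA].
  by move=> xy; have /forall_inP/(_ y yA)/implyP := cl x xA; apply.
by apply/forall_inP=> y yA; apply/implyP; apply: cl.
Qed.

Lemma clique_subset (A B : {set T}) : A \subset B -> clique e B -> clique e A.
Proof.
move=> /subsetP AB /cliqueP clB; apply/cliqueP=> x y xA yA.
by apply: clB; apply: AB.
Qed.

Lemma separation_inv s : separation e (inv_sep s) = separation e s.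
Proof.
wlog suff imp : s / separation e s -> separation e (inv_sep s).
  by apply/idP/idP=> /imp; rewrite ?inv_sepK.
case/separationP=> cover noedge; apply/separationP; split=> [x|x y] /=.
  by rewrite orbC.
by rewrite e_sym => xs ys; apply: noedge.
Qed.

Lemma clique_separation_inv s :
  clique_separation e (inv_sep s) = clique_separation e s.
Proof. by rewrite /clique_separation separation_inv /= setIC. Qed.

Lemma sep_order_inv s : sep_order (inv_sep s) = sep_order s.
Proof. by rewrite /sep_order setIC. Qed.

Lemma separation_meet r s :
  separation e r -> separation e s -> separation e (sep_meet r s).
Proof.
case/separationP=> rcov redge /separationP[scov sedge].
apply/separationP; split=> [x|x y] /=; rewrite !inE.
  by have := rcov x; have := scov x; do 4!case: (x \in _).
rewrite negb_or negb_and => /andP[xr xs] /orP[yr|ys]; first exact: redge.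
exact: sedge.
Qed.

(** Vertices of [A] outside [s.1] and outside [s.2] would be distinct, hence joined by an edge
    across the separation. *)
Lemma clique_side s (A : {set T}) : separation e s -> clique e A ->
  A \subset s.1 \/ A \subset s.2.
Proof.
case/separationP=> cover noedge /cliqueP cl.
case: (boolP (A \subset s.1)) => [|/subsetPn[x xA x1]]; first by left.
case: (boolP (A \subset s.2)) => [|/subsetPn[y yA y2]]; first by right.
case/negP: (noedge y x y2 x1); apply: cl => //.
by apply: contraNneq x1 => <-; have := cover y; rewrite (negPf y2) orbF.
Qed.

(** A separator vertex of the corner lying in [r.2] also lies in [r.1], hence in [s.2] by
    assumption. *)
Lemma meet_separator r s : r.1 :&: r.2 \subset s.2 ->
  (sep_meet r s).1 :&: (sep_meet r s).2 \subset s.1 :&: s.2.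
Proof.
move=> /subsetP rs; apply/subsetP=> x; rewrite !inE.
by move/(_ x): rs; rewrite inE; do 4!case: (x \in _) => //=; auto.
Qed.

Lemma clique_separation_meet r s :
  clique_separation e r -> clique_separation e s -> r.1 :&: r.2 \subset s.2 ->
  clique_separation e (sep_meet r s) /\ sep_order (sep_meet r s) <= sep_order s.
Proof.
move=> /andP[sep_r _] /andP[sep_s cl_s] /meet_separator rs.
by rewrite /clique_separation separation_meet // (clique_subset rs) // subset_leq_card.
Qed.

(** * Closure properties of profiles *)

Lemma profile_clique P s : profile e P -> s \in P -> clique_separation e s.
Proof.
by case=> k [[/subsetP Pk _] _ _] /Pk; rewrite inE => /andP[].
Qed.

(** The order of the profile is hidden in an existential; the member [t] serves as a witness that it
    exceeds the order of [s]. *)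
Lemma profile_orients P s t : profile e P -> t \in P ->
  clique_separation e s -> sep_order s <= sep_order t ->
  s \in P \/ inv_sep s \in P.
Proof.
case=> k [[/subsetP Pk one] _ _] /Pk; rewrite inE => /andP[_ ltk] cs le_st.
have /eqP/cards1P[u /setP/(_ u)] : #|P :&: orientations s| = 1.
  by apply: one; rewrite inE cs (leq_ltn_trans le_st).
by rewrite !inE eqxx => /andP[uP /orP[]/eqP uE]; [left|right]; rewrite -uE.
Qed.

Lemma profile_antisym P s :
  profile e P -> s \in P -> inv_sep s \in P -> inv_sep s = s.
Proof.
case=> k [[/subsetP Pk one] _ _] sP isP.
have /eqP/cards1P[u /setP uE] := one s (Pk _ sP).
have := uE s; have := uE (inv_sep s).
by rewrite !inE sP isP !eqxx orbT /= => /esym/eqP-> /esym/eqP.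
Qed.

(** Otherwise [inv_sep c] is in [P], and consistency with [s] leaves only [c = s]. *)
Lemma profile_down P s t c : profile e P -> t \in P -> s \in P ->
  clique_separation e c -> sep_order c <= sep_order t -> sep_le c s -> c \in P.
Proof.
move=> prP tP sP cc ct cs; have [//|icP] := profile_orients prP tP cc ct.
case: prP => k [_ /(_ _ _ icP sP)]; rewrite inv_sepK /sep_lt cs /= negbK.
by move/eqP->.
Qed.

(** The inverse of [c] is the join of [r] and [s]; the profile property excludes [c] itself. *)
Lemma profile_join P r s t : profile e P -> t \in P -> r \in P -> s \in P ->
  let c := sep_meet (inv_sep r) (inv_sep s) in
  clique_separation e c -> sep_order c <= sep_order t -> inv_sep c \in P.
Proof.
move=> prP tP rP sP c cc ct; have [cP|//] := profile_orients prP tP cc ct.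
by case: prP cP => k [_ _ /(_ _ _ rP sP)/negPf->].
Qed.

Lemma profile_not_small P s :
  profile e P -> inv_sep s \in P -> sep_le s (inv_sep s) -> s = inv_sep s.
Proof.
case=> k [_ cons _] sP le_s; apply/eqP; have := cons _ _ sP sP.
by rewrite inv_sepK /sep_lt le_s negbK.
Qed.

(** * Efficient separators of a pair of profiles *)

Lemma orientations_inv s : orientations (inv_sep s) = orientations s.
Proof. by rewrite /orientations inv_sepK setUC. Qed.

Lemma distinguishes_inv s P Q :
  distinguishes e s P Q -> distinguishes e (inv_sep s) P Q.
Proof.
by case=> cs rt; split; rewrite ?clique_separation_inv ?orientations_inv.
Qed.

Lemma distinguishes_sym s P Q : distinguishes e s P Q -> distinguishes e s Q P.
Proof.
by case=> cs [r [t [rP tQ rt]]]; split=> //; exists t, r; rewrite eq_sym.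
Qed.

Lemma distinguishesI s P Q : clique_separation e s ->
  s \in P -> inv_sep s \in Q -> s != inv_sep s -> distinguishes e s P Q.
Proof.
move=> cs sP sQ ne; split=> //; exists s, (inv_sep s).
by rewrite ne !inE sP sQ !eqxx orbT.
Qed.

Lemma distinguishesE s P Q : distinguishes e s P Q ->
  s != inv_sep s /\ (s \in P /\ inv_sep s \in Q \/ inv_sep s \in P /\ s \in Q).
Proof.
case=> _ [r [t []]]; rewrite !inE.
case/andP=> rP /orP[]/eqP rE; case/andP=> tQ /orP[]/eqP tE;
  by subst r t; rewrite ?eqxx // 1?[inv_sep s == s]eq_sym; auto.
Qed.

Definition distinguishesb s P Q :=
  clique_separation e s &&
  [exists r in P :&: orientations s, exists t in Q :&: orientations s, r != t].

Lemma distinguishesP s P Q :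
  reflect (distinguishes e s P Q) (distinguishesb s P Q).
Proof.
apply: (iffP andP) => -[cs H]; split=> //.
  by case/exists_inP: H => r rP /exists_inP[t tQ rt]; exists r, t.
case: H => r [t [rP tQ rt]]; apply/exists_inP; exists r => //.
by apply/exists_inP; exists t.
Qed.

(** Contains both orientations of each separator, and is empty for an indistinguishable pair. *)
Definition efficient P Q : {set vpair T} :=
  [set s | distinguishesb s P Q &
    [forall (t | distinguishesb t P Q), sep_order s <= sep_order t]].

Lemma efficientP s P Q :
  reflect (distinguishes_efficiently e s P Q) (s \in efficient P Q).
Proof.
rewrite inE; apply: (iffP andP) => -[ds H]; split; try exact/distinguishesP.
  by move=> t /distinguishesP dt; apply: (forall_inP H).
by apply/forall_inP=> t /distinguishesP; apply: H.
Qed.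

Lemma efficient_sym P Q : efficient P Q = efficient Q P.
Proof.
have sub P' Q' : efficient P' Q' \subset efficient Q' P'.
  apply/subsetP=> s /efficientP[ds H]; apply/efficientP; split.
    exact: distinguishes_sym.
  by move=> t /distinguishes_sym; apply: H.
by apply/eqP; rewrite eqEsubset !sub.
Qed.

Lemma efficient_inv s P Q : (inv_sep s \in efficient P Q) = (s \in efficient P Q).
Proof.
wlog suff imp : s / s \in efficient P Q -> inv_sep s \in efficient P Q.
  by apply/idP/idP=> /imp; rewrite ?inv_sepK.
case/efficientP=> ds H; apply/efficientP; split; first exact: distinguishes_inv.
by move=> t dt; rewrite sep_order_inv; apply: H.
Qed.

Lemma efficient_order s t P Q :
  s \in efficient P Q -> t \in efficient P Q -> sep_order s = sep_order t.
Proof.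
case/efficientP=> ds mins /efficientP[dt mint].
by apply/eqP; rewrite eqn_leq mins // mint.
Qed.

(** [Q] contains [c], which lies below [inv_sep r], while [P] contains the join [inv_sep c]. So [c]
    still distinguishes, at no larger order. *)
Lemma efficient_meet P Q r s : profile e P -> profile e Q ->
  r \in efficient P Q -> r \in P -> s \in P ->
  let c := sep_meet (inv_sep r) (inv_sep s) in
  clique_separation e c -> sep_order c <= sep_order r -> c \in efficient P Q.
Proof.
move=> prP prQ /efficientP[dr minr] rP sP c cc cr.
have [r_ne rPQ] := distinguishesE dr.
have rQ : inv_sep r \in Q.
  case: rPQ => [[]//|[irP _]].
  by rewrite (profile_antisym prP rP irP) eqxx in r_ne.
have cQ : c \in Q.
  by apply: (profile_down prQ rQ rQ cc _ (sep_meet_lel _ _)); rewrite sep_order_inv.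
have cP : inv_sep c \in P := profile_join prP rP rP sP cc cr.
apply/efficientP; split; last by move=> t /minr; apply: leq_trans.
apply/distinguishes_sym/distinguishesI => //.
(* If [c] were its own inverse, then [r] would lie below [inv_sep c = c] and hence below
   [inv_sep r], so [r] would be self-inverse by consistency of [Q]. *)
apply: contraNneq r_ne => cE; apply/eqP/(profile_not_small prQ rQ).
apply: sep_le_trans (sep_meet_lel _ (inv_sep s)).
by rewrite -/c cE sep_le_invC; apply: sep_meet_lel.
Qed.

Lemma efficient_corner P Q r s : profile e P -> profile e Q ->
  r \in efficient P Q -> r \in P -> s \in P -> s.1 :&: s.2 \subset r.1 ->
  sep_meet (inv_sep r) (inv_sep s) \in efficient P Q.
Proof.
move=> prP prQ rE rP sP sr.
have cr := profile_clique prP rP; have cs := profile_clique prP sP.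
have [||| cc ord_c] := @clique_separation_meet (inv_sep s) (inv_sep r).
- by rewrite clique_separation_inv.
- by rewrite clique_separation_inv.
- by rewrite setIC.
by apply: efficient_meet; rewrite // sep_meetC // -(sep_order_inv r).
Qed.

(** * Uncrossing efficient separators *)

Lemma efficient_cases P Q s : s \in efficient P Q ->
  s \in P /\ inv_sep s \in Q \/ inv_sep s \in P /\ s \in Q.
Proof. by case/efficientP=> /distinguishesE[]. Qed.

Lemma efficient_splinter_lt P Q r s : profile e P -> profile e Q ->
  clique_separation e r -> s \in efficient P Q -> sep_order r < sep_order s ->
  ~~ nested r s ->
  exists c, [/\ c \in efficient P Q, nested r c
    & forall t, nested t r -> nested t s -> nested t c].
Proof.
move=> prP prQ cr sE lt_rs rs.
(* Both profiles orient [r], whose order is too small to distinguish them, so they share an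
   orientation [r']. *)
have [r' [rr' r'P r'Q]] : exists r', [/\ r' \in orientations r, r' \in P & r' \in Q].
  have rO : r \in orientations r by apply: set21.
  have rO' : inv_sep r \in orientations r by apply: set22.
  have ndist : ~ distinguishes e r P Q.
    by case/efficientP: sE => _ mins /mins; rewrite leqNgt lt_rs.
  have orient R t : profile e R -> t \in R -> sep_order t = sep_order s ->
      r \in R \/ inv_sep r \in R.
    by move=> prR tR ord_t; apply: profile_orients prR tR cr _; rewrite ord_t ltnW.
  have [rP rQ] : (r \in P \/ inv_sep r \in P) /\ (r \in Q \/ inv_sep r \in Q).
    by case: (efficient_cases sE) => -[sP sQ];
      split; apply: orient; eauto; rewrite ?sep_order_inv.
  case: (eqVneq r (inv_sep r)) => [rE|ne].
    by exists r; split=> //; [case: rP|case: rQ]; rewrite -?rE.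
  case: rP rQ => rP [] rQ; first by exists r.
  - by case: ndist; apply: distinguishesI.
  - by case: ndist; apply/distinguishes_sym/distinguishesI.
  by exists (inv_sep r).
have nest_r t : nested t r' = nested t r by case/set2P: rr' => ->; rewrite ?nested_invr.
have corner R R' s' : profile e R -> profile e R' -> s' \in orientations s ->
    s' \in efficient R R' -> s' \in R -> r' \in R -> r'.1 :&: r'.2 \subset s'.1 ->
    exists c, [/\ c \in efficient R R', nested r c
      & forall t, nested t r -> nested t s -> nested t c].
  move=> prR prR' ss' s'E s'R r'R r's'.
  have nest_s t : nested t s' = nested t s.
    by case/set2P: ss' => ->; rewrite ?nested_invr.
  exists (sep_meet (inv_sep s') (inv_sep r')).
  split; first exact: efficient_corner.
    by rewrite nested_sym -nest_r -nested_invr nested_sym nested_meetr.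
  move=> t tr ts; apply: nested_meet; rewrite ?nested_invl nested_invr ?nest_r ?nest_s //.
  by rewrite nested_sym nest_s.
have /andP[sep_s _] : clique_separation e s by case/efficientP: sE => -[].
have /andP[_ clr] := profile_clique prP r'P.
have isE : inv_sep s \in efficient P Q by rewrite efficient_inv.
(* Orient [s] with the clique of [r] in its first side. Whichever profile contains this orientation
   also contains [r'], so [corner] applies. *)
have [r's|r's] := clique_side sep_s clr; case: (efficient_cases sE) => -[sP sQ].
- exact: corner prP prQ (set21 _ _) _ _ _ _.
- by rewrite efficient_sym in sE *; apply: corner prQ prP (set21 _ _) _ _ _ _.
- by rewrite efficient_sym in isE *; apply: corner prQ prP (set22 _ _) _ _ _ _.
- exact: corner prP prQ (set22 _ _) _ _ _ _.
Qed.

Lemma uncrossing_invl r s c c' :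
  uncrossing (@nested T) (inv_sep r) s c c' -> uncrossing (@nested T) r s c c'.
Proof.
by case=> sc nest2 nestr nests; split=> // t; move: (nest2 t) (nestr t);
  rewrite nested_invr.
Qed.

Lemma uncrossing_invr r s c c' :
  uncrossing (@nested T) r (inv_sep s) c c' -> uncrossing (@nested T) r s c c'.
Proof.
by case; rewrite !nested_invl => sc nest2 nestr nests; split=> // t;
  move: (nest2 t) (nests t); rewrite nested_invr.
Qed.

Lemma uncrossing_swap r s c c' :
  uncrossing (@nested T) r s c c' -> uncrossing (@nested T) r s c' c.
Proof.
case=> -[sc sc'] nest2 nestr nests; split=> // t.
- by move=> tr ts; have [] := nest2 t tr ts.
- by move/nestr=> []; auto.
- by move/nests=> []; auto.
Qed.

Lemma efficient_splinter_eq P Q P' Q' r s :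
  profile e P -> profile e Q -> profile e P' -> profile e Q' ->
  r \in efficient P Q -> s \in efficient P' Q' -> sep_order r = sep_order s ->
  ~~ nested r s ->
  (exists c c', [/\ uncrossing (@nested T) r s c c',
     c \in efficient P Q & c' \in efficient P' Q']) \/
  (exists c c' d d', [/\ uncrossing (@nested T) r s c c',
     uncrossing (@nested T) r s d d',
     c \in efficient P Q /\ c' \in efficient P Q
   & d \in efficient P' Q' /\ d' \in efficient P' Q']).
Proof.
move=> prP prQ prP' prQ'.
wlog rs1 : s / r.1 :&: r.2 \subset s.1 => [hw rE sE|].
  have /andP[sep_s _] : clique_separation e s by case/efficientP: sE => -[].
  have /andP[_ clr] : clique_separation e r by case/efficientP: rE => -[].
  have [?|?] := clique_side sep_s clr; first exact: hw.
  rewrite -(efficient_inv s) in sE; rewrite -(sep_order_inv s) -(nested_invr r) => o n.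
  have := hw (inv_sep s); case=> // [[c [c' [u ? ?]]]|[c [c' [d [d' [u v ? ?]]]]]].
    by left; exists c, c'; split=> //; apply: uncrossing_invr.
  by right; exists c, c', d, d'; split=> //; apply: uncrossing_invr.
wlog sr1 : r rs1 / s.1 :&: s.2 \subset r.1 => [hw rE sE|].
  have /andP[sep_r _] : clique_separation e r by case/efficientP: rE => -[].
  have /andP[_ cls] : clique_separation e s by case/efficientP: sE => -[].
  have [?|?] := clique_side sep_r cls; first exact: hw.
  rewrite -(efficient_inv r) in rE; rewrite -(sep_order_inv r) -(nested_invl r) => o n.
  case: (hw (inv_sep r)) => //; first by rewrite setIC.
    move=> [c [c' [u ? ?]]].
    by left; exists c, c'; split=> //; apply: uncrossing_invl.
  move=> [c [c' [d [d' [u v ? ?]]]]].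
  by right; exists c, c', d, d'; split=> //; apply: uncrossing_invl.
move=> rE sE ord_rs rs.
have cr : clique_separation e r by case/efficientP: rE => -[].
have cs : clique_separation e s by case/efficientP: sE => -[].
(* With [r = (A, B)] and [s = (C, D)], each corner is named after the sides it intersects; both
   separators lie in [A :&: C]. *)
set BD := sep_meet (inv_sep r) (inv_sep s).
pose BC := sep_meet (inv_sep r) s.
pose AD := sep_meet r (inv_sep s).
pose AC := sep_meet r s.
have uACBD : uncrossing (@nested T) r s AC BD by apply: uncrossing_meet.
have uADBC : uncrossing (@nested T) r s AD BC.
  apply: uncrossing_invr; have := @uncrossing_meet _ r (inv_sep s).
  by rewrite inv_sepK nested_invr; apply.
have uBDAC := uncrossing_swap uACBD; have uBCAD := uncrossing_swap uADBC.
(* A profile containing r0 lives in one of the two corners beyond r0. *)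
have FA R R' : profile e R -> profile e R' -> forall r0 s0,
    r0 \in efficient R R' -> clique_separation e s0 ->
    sep_order r0 = sep_order s0 -> s0.1 :&: s0.2 \subset r0.1 -> r0 \in R ->
    sep_meet (inv_sep r0) (inv_sep s0) \in efficient R R' \/
    sep_meet (inv_sep r0) s0 \in efficient R R'.
  move=> prR prR' r0 s0 r0E cs0 ord0 s0r0 r0R.
  have [s0R|s0R] : s0 \in R \/ inv_sep s0 \in R.
    by apply: profile_orients prR r0R cs0 _; rewrite ord0.
    by left; apply: efficient_corner.
  by right; rewrite -{1}(inv_sepK s0); apply: efficient_corner; rewrite // setIC.
have FAr : BD \in efficient P Q \/ BC \in efficient P Q.
  case: (efficient_cases rE) => -[rP rQ]; first exact: FA.
  by rewrite efficient_sym in rE *; apply: FA.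
have FAs : BD \in efficient P' Q' \/ AD \in efficient P' Q'.
  rewrite /BD /AD sep_meetC [sep_meet r _]sep_meetC.
  case: (efficient_cases sE) => -[sP sQ]; first exact: FA.
  by rewrite efficient_sym in sE *; apply: FA.
(* The separator of [BD] lies in those of [r] and [s]. Efficiency gives it the same size, so all
   three coincide. *)
have eqAB : BD \in efficient P Q \/ BD \in efficient P' Q' ->
    r.1 :&: r.2 = s.1 :&: s.2.
  move=> BDE; have ordBD : sep_order BD = sep_order r.
    by case: BDE => /efficient_order; [apply|rewrite ord_rs; apply].
  have BDr : BD.1 :&: BD.2 \subset r.1 :&: r.2.
    by rewrite [r.1 :&: _]setIC /BD sep_meetC;
      apply: (@meet_separator _ (inv_sep r)); rewrite setIC.
  have BDs : BD.1 :&: BD.2 \subset s.1 :&: s.2.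
    by rewrite [s.1 :&: _]setIC; apply: (@meet_separator _ (inv_sep s)); rewrite setIC.
  have /eqP <- : BD.1 :&: BD.2 == r.1 :&: r.2.
    by rewrite eqEcard BDr; apply/eq_leq/esym.
  by apply/eqP; rewrite eqEcard BDs; apply/eq_leq/esym; rewrite -[RHS]ord_rs.
(* A common separator lies in both sides of [r] and [s], so [FA] also applies to the reversed
   orientations. *)
have GAr : r.1 :&: r.2 = s.1 :&: s.2 ->
    AC \in efficient P Q \/ AD \in efficient P Q.
  move=> sepE; have sub : s.2 :&: s.1 \subset r.2 by rewrite setIC -sepE subsetIr.
  have irE : inv_sep r \in efficient P Q by rewrite efficient_inv.
  have ics : clique_separation e (inv_sep s) by rewrite clique_separation_inv.
  have o : sep_order (inv_sep r) = sep_order (inv_sep s) by rewrite !sep_order_inv.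
  case: (efficient_cases rE) => -[rP rQ].
    have := FA Q P prQ prP _ (inv_sep s) _ ics o sub rQ.
    by rewrite !inv_sepK efficient_sym; apply.
  by have := FA P Q prP prQ _ (inv_sep s) _ ics o sub rP; rewrite !inv_sepK; apply.
have GAs : r.1 :&: r.2 = s.1 :&: s.2 ->
    AC \in efficient P' Q' \/ BC \in efficient P' Q'.
  move=> sepE; have sub : r.2 :&: r.1 \subset s.2 by rewrite setIC sepE subsetIr.
  have isE : inv_sep s \in efficient P' Q' by rewrite efficient_inv.
  have icr : clique_separation e (inv_sep r) by rewrite clique_separation_inv.
  have o : sep_order (inv_sep s) = sep_order (inv_sep r) by rewrite !sep_order_inv.
  rewrite /AC /BC sep_meetC [sep_meet _ s]sep_meetC.
  case: (efficient_cases sE) => -[sP sQ].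
    have := FA Q' P' prQ' prP' _ (inv_sep r) _ icr o sub sQ.
    by rewrite !inv_sepK efficient_sym; apply.
  by have := FA P' Q' prP' prQ' _ (inv_sep r) _ icr o sub sP; rewrite !inv_sepK; apply.
(* Either two opposite corners can be shared out, one to each pair of profiles, or each pair of
   profiles gets both corners of one opposite pair. *)
case: FAr FAs => [BDr|BCr] [BDs|ADs]; last by left; exists BC, AD.
- have sepE : r.1 :&: r.2 = s.1 :&: s.2 by apply: eqAB; left.
  left; case: (GAr sepE) (GAs sepE) => [ACr _|ADr [ACs|BCs]].
  + by exists AC, BD.
  + by exists BD, AC.
  + by exists AD, BC.
- have sepE : r.1 :&: r.2 = s.1 :&: s.2 by apply: eqAB; left.
  case: (GAr sepE) (GAs sepE) => [ACr [ACs|BCs]|ADr [ACs|BCs]].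
  + by left; exists BD, AC.
  + by right; exists BD, AC, AD, BC.
  + by left; exists BD, AC.
  + by left; exists AD, BC.
- have sepE : r.1 :&: r.2 = s.1 :&: s.2 by apply: eqAB; right.
  case: (GAr sepE) (GAs sepE) => [ACr _|ADr [ACs|BCs]].
  + by left; exists AC, BD.
  + by right; exists AD, BC, BD, AC.
  + by left; exists AD, BC.
Qed.

End CliqueSeparations.

(** * Canonicity *)

Section Action.
Variables (T : finType) (e : rel T).
Implicit Types (r s t : vpair T) (P Q : {set vpair T}) (a : {perm T}).

Lemma sep_actK a : cancel (sep_act a) (sep_act a^-1).
Proof.
have imK (A : {set T}) : a^-1%g @: (a @: A) = A.
  by rewrite -imset_comp -[RHS]imset_id; apply: eq_imset => x /=; rewrite permK.
by case=> A B; rewrite /sep_act /= !imK.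
Qed.

Lemma sep_actKV a : cancel (sep_act a^-1) (sep_act a).
Proof. by move=> s; rewrite -{1}(invgK a) sep_actK. Qed.

Lemma sep_act_inj a : injective (sep_act a).
Proof. exact: can_inj (sep_actK a). Qed.

Lemma seps_actK a : cancel (seps_act a) (seps_act a^-1).
Proof.
by move=> P; rewrite /seps_act -imset_comp -[RHS]imset_id;
  apply: eq_imset => s /=; rewrite sep_actK.
Qed.

Lemma automorphismV a : automorphism e a -> automorphism e a^-1.
Proof. by move=> aut x y; rewrite -aut !permKV. Qed.

Lemma inv_sep_act a s : inv_sep (sep_act a s) = sep_act a (inv_sep s).
Proof. by []. Qed.

Lemma sep_le_act a : {mono sep_act a : r s / sep_le r s}.
Proof.
have sub : {mono (fun A : {set T} => a @: A) : A B / A \subset B}.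
  move=> A B /=; apply/idP/idP=> [/subsetP sub|]; last exact: imsetS.
  by apply/subsetP=> x /(imset_f a)/sub; rewrite mem_imset //; apply: perm_inj.
by move=> r s; rewrite /sep_le /= !sub.
Qed.

Lemma nested_act a : {mono sep_act a : r s / nested r s}.
Proof. by move=> r s; rewrite !nestedE !inv_sep_act !sep_le_act. Qed.

Lemma sep_order_act a s : sep_order (sep_act a s) = sep_order s.
Proof.
by rewrite /sep_order -imsetI ?card_imset //;
  [apply: perm_inj|move=> x y _ _; apply: perm_inj].
Qed.

Lemma clique_separation_act a s : automorphism e a ->
  clique_separation e s -> clique_separation e (sep_act a s).
Proof.
move=> aut /andP[/separationP[cover noedge] /cliqueP cl].
have mem_a x (A : {set T}) : (x \in a @: A) = (a^-1%g x \in A).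
  by rewrite -{1}(permKV a x) mem_imset //; apply: perm_inj.
have autV := automorphismV aut.
apply/andP; split.
  apply/separationP; split=> [x|x y]; rewrite /= !mem_a // -autV.
  exact: noedge.
apply/cliqueP=> x y; rewrite !inE !mem_a -!in_setI => xs ys xy.
by rewrite -autV; apply: cl => //; rewrite (inj_eq perm_inj).
Qed.

Lemma distinguishes_act a s P Q : automorphism e a ->
  distinguishes e s P Q ->
  distinguishes e (sep_act a s) (seps_act a P) (seps_act a Q).
Proof.
move=> aut [cs [r [t [rP tQ rt]]]]; split; first exact: clique_separation_act.
have orient u R : u \in R :&: orientations s ->
    sep_act a u \in seps_act a R :&: orientations (sep_act a s).
  rewrite !inE inv_sep_act !(inj_eq (@sep_act_inj a)) => /andP[uR ->].
  by rewrite imset_f.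
by exists (sep_act a r), (sep_act a t); rewrite (inj_eq (@sep_act_inj a)); split; auto.
Qed.

(** One inclusion is shown for every automorphism; the other is that inclusion for the inverse. *)
Lemma efficient_act a P Q : automorphism e a ->
  efficient e (seps_act a P) (seps_act a Q) = sep_act a @: efficient e P Q.
Proof.
have sub b P' Q' s : automorphism e b -> s \in efficient e P' Q' ->
    sep_act b s \in efficient e (seps_act b P') (seps_act b Q').
  move=> aut /efficientP[ds mins]; apply/efficientP; split.
    exact: distinguishes_act.
  move=> t /(distinguishes_act (automorphismV aut)); rewrite !seps_actK => /mins.
  by rewrite !sep_order_act.
move=> aut; apply/setP=> s; apply/idP/imsetP=> [sE|[t tE ->]]; last exact: sub.
exists (sep_act a^-1 s); last by rewrite sep_actKV.
by rewrite -(seps_actK a P) -(seps_actK a Q); apply/sub/sE/automorphismV.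
Qed.

Definition efficient_family (PP : {set {set vpair T}}) : {set {set vpair T}} :=
  [set efficient e P Q | P in PP, Q in PP].

Lemma efficient_family_act a PP : automorphism e a ->
  efficient_family (profiles_act a PP) =
  [set sep_act a @: A | A : {set vpair T} in efficient_family PP].
Proof.
move=> aut; apply/setP=> A; apply/imset2P/imsetP.
  case=> _ _ /imsetP[P PPP ->] /imsetP[Q QPP ->] ->.
  by exists (efficient e P Q); [apply: imset2_f|rewrite efficient_act].
case=> _ /imset2P[P Q PPP QPP ->] ->.
by exists (seps_act a P) (seps_act a Q); rewrite ?imset_f ?efficient_act.
Qed.

End Action.

Theorem theorem17 (T : finType) (e : rel T)
    (e_sym : symmetric e) (e_irr : irreflexive e) :
  exists N : {set {set vpair T}} -> {set vpair T},
    forall PP : {set {set vpair T}}, {in PP, forall P, profile e P} ->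
      [/\ {in N PP, forall s, separation e s},
          nested_set (N PP),
          {in PP &, forall P Q, distinguishable e P Q ->
             exists2 s, s \in N PP & distinguishes_efficiently e s P Q}
        & forall a : {perm T}, automorphism e a ->
             N (profiles_act a PP) = seps_act a (N PP)].
Proof.
(* Orders are at most [#|T|], so stage [#|T|.+1] has treated all of them. *)
exists (fun PP => splinter (@nested T) (@sep_order T) (efficient_family e PP) #|T|.+1).
move=> PP prPP; set F := efficient_family e PP.
have homog A s t : A \in F -> s \in A -> t \in A -> sep_order s = sep_order t.
  by case/imset2P=> P Q _ _ ->; apply: efficient_order.
have lt A B r s : A \in F -> B \in F -> r \in A -> s \in B ->
    sep_order r < sep_order s -> ~~ nested r s ->
    exists c, [/\ c \in B, nested r c
      & forall t, nested t r -> nested t s -> nested t c].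
  case/imset2P=> P Q _ _ -> /imset2P[P' Q' P'PP Q'PP ->] /efficientP[[cr _] _].
  by move=> sE lt_rs rs; apply: efficient_splinter_lt => //; apply: prPP.
have eq A B r s : A \in F -> B \in F -> r \in A -> s \in B ->
    sep_order r = sep_order s -> ~~ nested r s ->
    (exists c c', [/\ uncrossing (@nested T) r s c c', c \in A & c' \in B]) \/
    (exists c c' d d', [/\ uncrossing (@nested T) r s c c',
      uncrossing (@nested T) r s d d', c \in A /\ c' \in A & d \in B /\ d' \in B]).
  case/imset2P=> P Q ? ? -> /imset2P[P' Q' ? ? ->].
  by move=> rE sE o rs; apply: efficient_splinter_eq => //; apply: prPP.
split.
- move=> s /splinterP[A [/imset2P[P Q _ _ ->] /efficientP[[/andP[] //]]]].
- exact: splinter_nest (@nested_sym T) homog eq _.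
- move=> P Q PPP QPP [s0 d0].
  (* A distinguisher of least order exists, so the set of efficient ones is nonempty and the
     selection meets it. *)
  have [s /distinguishesP ds mins] :
      exists2 s, distinguishesb e s P Q &
        forall t, distinguishesb e t P Q -> sep_order s <= sep_order t.
    move/distinguishesP: d0 => d0.
    by case: (@arg_minnP _ s0 (fun s => distinguishesb e s P Q) (@sep_order T) d0) 
      => s ds mins; exists s.
  have sE : s \in efficient e P Q.
    by apply/efficientP; split=> // t /distinguishesP; apply: mins.
  have FE : efficient e P Q \in F by apply: imset2_f.
  have [|c cE cN] := splinter_meets (@nested_sym T) homog lt eq FE sE (n := #|T|.+1).
    by rewrite ltnS max_card.
  by exists c => //; apply/efficientP.
- move=> a aut; rewrite efficient_family_act //.
  exact: splinter_imset (@sep_act_inj _ a) (nested_act a) (sep_order_act a) _ _.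
Qed.
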